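(* Let $H$ be a self-adjoint operator in a separable Hilbert space $\mathfrak{H}$, let $\mathfrak{K}$ be a separable Hilbert space, and let $F=J\circ M_w\circ\mathfrak{U}_H:\mathfrak{H}\to\mathfrak{K}$ be the rigging operator associated with a weight function $w:\mathbb{R}\to(0,\infty)$, $w\in C_0(\mathbb{R})$, and a bounded operator $J:L^2(\mathbb{R},d\mu_H)\to\mathfrak{K}$. For $\lambda\in\mathbb{R}$ and $y>0$ put $T_{\lambda+iy}:=F(H-\lambda-iy)^{-1}F^*$. Let $\lambda\in\sigma_{\mathrm p}(H)$ be an isolated eigenvalue of $H$ of finite multiplicity, and let $P_\lambda$ be the orthogonal projector onto $V_\lambda=\ker(H-\lambda I)$. If $FP_\lambda\neq 0$, then $\|T_{\lambda+iy}\|\to\infty$ as $y\downarrow 0$, where $\|\cdot\|$ is the operator norm on $\mathfrak{K}$.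
   Context: Hilbert spaces are complex. $H$ is a self-adjoint (possibly unbounded) operator in $\mathfrak{H}$ and $\sigma_{\mathrm p}(H)$ is its point spectrum (set of eigenvalues). By the spectral theorem, in the case of multiplicity one (assumed here for simplicity), there is a Borel measure $\mu_H$ on $\mathbb{R}$ and a unitary operator $\mathfrak{U}_H:\mathfrak{H}\to L^2(\mathbb{R},d\mu_H)$ (the spectral transformation) such that $\mathfrak{U}_H H\mathfrak{U}_H^{-1}$ is the operator of multiplication by the independent variable $x$. $C_0(\mathbb{R})$ denotes the continuous functions on $\mathbb{R}$ that tend to $0$ as $|x|\to\infty$. $M_w$ is the multiplication operator $(M_wf)(x)=w(x)f(x)$ on $L^2(\mathbb{R},d\mu_H)$. *)

(* Defs.v *)
From HB Require Import structures.
From mathcomp Require Import all_boot all_order all_algebra.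
From mathcomp Require Import generic_quotient ring_quotient complex.
From mathcomp Require Import all_classical all_reals all_analysis.
From mathcomp Require Import measurable_realfun.

Set Implicit Arguments.
Unset Strict Implicit.
Unset Printing Implicit Defensive.

Import Order.TTheory GRing.Theory Num.Theory Num.Def.
Import numFieldNormedType.Exports.

Local Open Scope classical_set_scope.
Local Open Scope complex_scope.
Local Open Scope ring_scope.

Local Notation Re := (@complex.Re _).
Local Notation Im := (@complex.Im _).

Section DotNorm.
Variables (C : numClosedFieldType) (U : lmodType C) (form : {dot U for (@conjC C)}).
Implicit Types u v : U.

Definition dot_norm u : C := sqrtC (form u u).

Lemma dot_norm_ge0 u : 0 <= dot_norm u.
Proof. by rewrite sqrtC_ge0 dnorm_ge0. Qed.

Lemma dot_normK u : dot_norm u ^+ 2 = form u u.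
Proof. by rewrite sqrtCK. Qed.

Lemma dot_normZ (a : C) u : dot_norm (a *: u) = `|a| * dot_norm u.
Proof.
apply/eqP; rewrite -(@eqrXn2 _ 2%N) ?mulr_ge0 ?dot_norm_ge0//.
by rewrite exprMn !dot_normK dnormZ.
Qed.

Lemma dot_norm_eq0 u : dot_norm u = 0 -> u = 0.
Proof. by move/eqP; rewrite sqrtC_eq0 dnorm_eq0 => /eqP. Qed.

Lemma cauchy_schwarz u v : `|form u v| <= dot_norm u * dot_norm v.
Proof.
have [->|v0] := eqVneq v 0.
  by rewrite linear0r normr0 mulr_ge0 ?dot_norm_ge0.
have vv : form v v != 0 by rewrite dnorm_eq0.
pose a := form u v / form v v.
pose x := u - a *: v.
have o : form x v = 0.
  by rewrite /x linearBl linearZl_LR/= /a divfK// subrr.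
have uE : form u u = form x x + `|a| ^+ 2 * form v v.
  rewrite -dnormZ; have -> : form u u = form (x + a *: v) (x + a *: v).
    by rewrite /x subrK.
  have o' : form x (a *: v) = 0 by rewrite linearZr_LR/= o mulr0.
  by rewrite dnormD/= o' rmorph0 !addr0.
rewrite -(@ler_pXn2r _ 2%N) ?nnegrE ?mulr_ge0 ?dot_norm_ge0//.
rewrite exprMn !dot_normK uE mulrDl -[leLHS]add0r lerD ?mulr_ge0 ?dnorm_ge0//.
have -> : form u v = a * form v v by rewrite /a divfK.
by rewrite normrM exprMn (ger0_norm (dnorm_ge0 _ _)) expr2 mulrA.
Qed.

Lemma ler_dot_normD u v : dot_norm (u + v) <= dot_norm u + dot_norm v.
Proof.
rewrite -(@ler_pXn2r _ 2%N) ?nnegrE ?addr_ge0 ?dot_norm_ge0// dot_normK dnormD/=.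
rewrite sqrrD !dot_normK [leRHS]addrAC lerD2l.
have dr : form u v + (form u v)^* \is Num.real.
  by apply/CrealP; rewrite rmorphD/= conjCK addrC.
apply: le_trans (real_ler_norm dr) _.
apply: le_trans (ler_normD _ _) _.
by rewrite norm_conjC -mulr2n lerMn2r cauchy_schwarz orbT.
Qed.

End DotNorm.

(* The form is linear in its first argument and conjugate-linear in the second. *)
HB.mixin Record NormedModule_isPreHilbert (R : realType) V
    of NormedModule R[i] V := {
  inner : {dot V for (@conjC R[i])} ;
  inner_norm : forall u : V, inner u u = `|u| ^+ 2
}.

#[short(type="preHilbertType")]
HB.structure Definition PreHilbert (R : realType) :=
  {V of NormedModule R[i] V & NormedModule_isPreHilbert R V}.

#[short(type="hilbertType")]
HB.structure Definition Hilbert (R : realType) :=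
  {V of PreHilbert R V & Complete V}.

HB.factory Record Lmodule_isPreHilbert (R : realType) V
    of GRing.Lmodule R[i] V := {
  form : {dot V for (@conjC R[i])}
}.

HB.builders Context R V of Lmodule_isPreHilbert R V.

HB.instance Definition _ := Lmodule_isNormed.Build R[i] V
  (@ler_dot_normD _ _ form) (@dot_normZ _ _ form) (@dot_norm_eq0 _ _ form).
HB.instance Definition _ := NormedModule_isPreHilbert.Build R V
  (fun u => esym (dot_normK form u)).

HB.end.

Section ComplexL2.
Context d (T : measurableType d) (R : realType).
Variable mu : {measure set T -> \bar R}.
Implicit Types f g h : T -> R[i].

Definition cintegrable f :=
  mu.-integrable setT (EFin \o (Re \o f)) /\
  mu.-integrable setT (EFin \o (Im \o f)).

Definition cintegral f : R[i] :=
  (\int[mu]_x Re (f x)) +i* (\int[mu]_x Im (f x)).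

Lemma cintegrableD f g : cintegrable f -> cintegrable g ->
  cintegrable (fun x => f x + g x).
Proof.
move=> [rf mf] [rg mg]; split.
- by apply: eq_integrable (integrableD measurableT rf rg) => // x _ /=; case: (f x) (g x) => ? ? [].
- by apply: eq_integrable (integrableD measurableT mf mg) => // x _ /=; case: (f x) (g x) => ? ? [].
Qed.

Lemma cintegralD f g : cintegrable f -> cintegrable g ->
  cintegral (fun x => f x + g x) = cintegral f + cintegral g.
Proof.
move=> [rf mf] [rg mg]; rewrite /cintegral.
under [X in X +i* _]eq_Rintegral do rewrite raddfD/=.
under [X in _ +i* X]eq_Rintegral do rewrite raddfD/=.
by rewrite !RintegralD.
Qed.

Lemma cintegrableZ (a : R[i]) f : cintegrable f ->
  cintegrable (fun x => a * f x).
Proof.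
move: a => [a b] [rf mf]; split.
- have := integrableB measurableT (integrableZl measurableT a rf)
    (integrableZl measurableT b mf).
  by apply: eq_integrable => // x _ /=; case: (f x).
- have := integrableD measurableT (integrableZl measurableT a mf)
    (integrableZl measurableT b rf).
  by apply: eq_integrable => // x _ /=; case: (f x).
Qed.

Lemma cintegralZ (a : R[i]) f : cintegrable f ->
  cintegral (fun x => a * f x) = a * cintegral f.
Proof.
move: a => [a b] [rf mf]; rewrite /cintegral; apply/eqP; rewrite eq_complex/=.
apply/andP; split; apply/eqP.
- rewrite -!RintegralZl// -RintegralB//; last 2 first.
  + exact: (integrableZl measurableT a rf).
  + exact: (integrableZl measurableT b mf).
  by apply: eq_Rintegral => x _; case: (f x).
- rewrite -!RintegralZl// -RintegralD//; last 2 first.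
  + exact: (integrableZl measurableT a mf).
  + exact: (integrableZl measurableT b rf).
  by apply: eq_Rintegral => x _; case: (f x).
Qed.

Lemma cintegral_conj f : cintegrable f ->
  cintegral (fun x => (f x)^*) = (cintegral f)^*.
Proof.
move=> [rf mf]; apply/eqP; rewrite eq_complex/=; apply/andP; split; apply/eqP.
- by apply: eq_Rintegral => x _; case: (f x).
- rewrite -[RHS]mulN1r -RintegralZl//.
  by apply: eq_Rintegral => x _; case: (f x) => ? ?; rewrite mulN1r.
Qed.

Lemma ae_eq_cintegral f g : cintegrable f -> cintegrable g ->
  (\forall x \ae mu, f x = g x) -> cintegral f = cintegral g.
Proof.
move=> [/measurable_int rf /measurable_int mf] [/measurable_int rg /measurable_int mg] fg.
rewrite /cintegral /Rintegral; congr (fine _ +i* fine _).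
- by apply: ae_eq_integral => //; apply: filterS fg => x /= ->.
- by apply: ae_eq_integral => //; apply: filterS fg => x /= ->.
Qed.

Definition L2fun : {pred T -> R[i]} :=
  mem [set f : T -> R[i] | [/\ measurable_fun setT (Re \o f), measurable_fun setT (Im \o f) &
    (\int[mu]_x (Re (`|f x| ^+ 2))%:E < +oo)%E]].

Lemma Re_sqr_norm (z : R[i]) : Re (`|z| ^+ 2) = Re z ^+ 2 + Im z ^+ 2.
Proof. by rewrite -add_Re2_Im2. Qed.

Lemma L2funP (f : T -> R[i]) : f \in L2fun <->
  (Re \o f \in Lfun mu 2%:E) /\ (Im \o f \in Lfun mu 2%:E).
Proof.
have key (h : T -> R) : measurable_fun setT h -> (\int[mu]_x (h x ^+ 2)%:E < +oo)%E ->
    h \in Lfun mu 2%:E.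
  move=> mh ih; rewrite inE; apply/andP; split; rewrite inE//=.
  rewrite /finite_norm unlock; apply: poweR_lty.
  apply: le_lt_trans ih; rewrite le_eqVlt; apply/orP; left; apply/eqP.
  by apply: eq_integral => x _; rewrite /= powR_mulrn// real_normK ?num_real.
have sub (h h' : T -> R) : measurable_fun setT h -> measurable_fun setT h' ->
  (\int[mu]_x (h x ^+ 2 + h' x ^+ 2)%:E < +oo)%E ->
  (\int[mu]_x (h x ^+ 2)%:E < +oo)%E.
  move=> mh mh'; apply: le_lt_trans; apply: ge0_le_integral => //.
  - by move=> x _; rewrite lee_fin sqr_ge0.
  - exact/measurable_EFinP/measurable_funX.
  - by apply/measurable_EFinP/measurable_funD; exact/measurable_funX.
  - by move=> x _; rewrite lee_fin lerDl sqr_ge0.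
split.
  move=> /set_mem [mr mi]; under eq_integral do rewrite Re_sqr_norm.
  move=> i; split; apply: key => //.
    exact: sub i.
  by apply: (sub _ (Re \o f)) => //; under eq_integral do rewrite addrC.
move=> [r i]; have := Lfun2_integrable_sqr r; have := Lfun2_integrable_sqr i.
move: r i; rewrite !inE => /andP[/[!inE]/= mr _] /andP[/[!inE]/= mi _] ii ir.
split => //; have /integrableP[_] := integrableD measurableT ir ii.
apply: le_lt_trans; rewrite le_eqVlt; apply/orP; left; apply/eqP.
apply: eq_integral => x _.
rewrite [LHS](_ : _ = (Re (`|f x| ^+ 2))%:E)//.
by rewrite Re_sqr_norm /= ger0_norm// addr_ge0 ?sqr_ge0.
Qed.

Lemma L2fun_submod_closed : submod_closed L2fun.
Proof.
have [h0 hl] := @Lfun_submod_closed _ T R mu 2%:E (lee1n 2).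
split=> [|a f g /L2funP[rf mf] /L2funP[rg mg]]; apply/L2funP; first by [].
case: a => a b; split.
- have -> : Re \o ((a +i* b) *: f + g) =
            a *: (Re \o f) + ((- b) *: (Im \o f) + (Re \o g)).
    apply/funext => x; rewrite /= !fctE /= addrA scaleNr.
    by case: (f x) (g x) => ? ? [].
  exact/hl/hl.
- have -> : Im \o ((a +i* b) *: f + g) =
            a *: (Im \o f) + (b *: (Re \o f) + (Im \o g)).
    apply/funext => x; rewrite /= !fctE /= addrA.
    by case: (f x) (g x) => ? ? [].
  exact/hl/hl.
Qed.

HB.instance Definition _ := GRing.isSubmodClosed.Build _ _ L2fun
  L2fun_submod_closed.

Record L2pre := { L2pre_fun :> T -> R[i] ; L2pre_funP : L2pre_fun \in L2fun }.

HB.instance Definition _ := [isSub for L2pre_fun].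
HB.instance Definition _ := [Choice of L2pre by <:].
HB.instance Definition _ := [SubChoice_isSubLmodule of L2pre by <:].

Definition L2null : {pred L2pre} :=
  mem [set u : L2pre | \forall x \ae mu, u x = 0].

Lemma L2null_zmod_closed : zmod_closed L2null.
Proof.
split=> [|u v]; first by rewrite inE/=; exact: nearW.
rewrite !inE/= => u0 v0; near=> x.
by rewrite !fctE/= (near u0 x)// (near v0 x)// subrr.
Unshelve. all: by end_near. Qed.

HB.instance Definition _ := GRing.isZmodClosed.Build _ L2null
  L2null_zmod_closed.

(* Complex L^2: square-integrable functions modulo a.e. equality, see L2_piP.
   The library's Lp spaces only contain real-valued functions. *)
Definition L2 := Quotient.quot L2null.
HB.instance Definition _ := GRing.Zmodule.on L2.
HB.instance Definition _ := EqQuotient.on L2.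

Local Open Scope quotient_scope.

Lemma L2_piP (f g : L2pre) :
  \pi_L2 f = \pi_L2 g <-> \forall x \ae mu, f x = g x.
Proof.
split=> [/eqP|fg].
- rewrite -Quotient.idealrBE inE/=; apply: filterS => x /eqP.
  by rewrite !fctE/= subr_eq0 => /eqP.
- apply/eqP; rewrite -Quotient.idealrBE inE/=; apply: filterS fg => x.
  by rewrite !fctE/= => ->; rewrite subrr.
Qed.

Lemma L2_reprP (f : L2pre) : \forall x \ae mu, repr (\pi_L2 f) x = f x.
Proof. by apply/L2_piP; rewrite reprK. Qed.

Lemma L2P (u v : L2) : u = v <-> \forall x \ae mu, repr u x = repr v x.
Proof. by rewrite -L2_piP !reprK. Qed.

Lemma L2_piD (f g : L2pre) : \pi_L2 (f + g) = \pi_L2 f + \pi_L2 g.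
Proof. exact: (@Quotient.pi_add _ L2null). Qed.

Lemma L2_pi0 : \pi_L2 0 = 0.
Proof. by apply: (addIr (\pi_L2 0)); rewrite -L2_piD addr0 add0r. Qed.

Definition L2_scale (a : R[i]) (u : L2) : L2 := \pi_L2 (a *: repr u).

Lemma L2_pi_scale a (f : L2pre) : \pi_L2 (a *: f) = L2_scale a (\pi_L2 f).
Proof.
apply/L2_piP; apply: filterS (L2_reprP f) => x fx.
by change (a * f x = a * repr (\pi_L2 f) x); rewrite fx.
Qed.

Lemma L2_scaleA a b u : L2_scale a (L2_scale b u) = L2_scale (a * b) u.
Proof. by rewrite -[u]reprK -!L2_pi_scale scalerA reprK. Qed.

Lemma L2_scale1 : left_id 1 L2_scale.
Proof. by move=> u; rewrite /L2_scale scale1r reprK. Qed.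

Lemma L2_scaleDr : right_distributive L2_scale +%R.
Proof.
move=> a u v; rewrite -[u]reprK -[v]reprK -L2_piD -!L2_pi_scale.
by rewrite scalerDr L2_piD.
Qed.

Lemma L2_scaleDl u : {morph L2_scale^~ u : a b / a + b}.
Proof. by move=> a b; rewrite /L2_scale scalerDl L2_piD. Qed.

HB.instance Definition _ := GRing.Zmodule_isLmodule.Build R[i] L2
  L2_scaleA L2_scale1 L2_scaleDr L2_scaleDl.

Lemma L2_piZ a (f : L2pre) : \pi_L2 (a *: f) = a *: \pi_L2 f.
Proof. exact: L2_pi_scale. Qed.

Lemma L2_integrable (f g : L2pre) : cintegrable (fun x => f x * (g x)^*).
Proof.
have /L2funP[rf mf] := L2pre_funP f; have /L2funP[rg mg] := L2pre_funP g.
have I (h k : T -> R) : h \in Lfun mu 2%:E -> k \in Lfun mu 2%:E ->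
    mu.-integrable setT (EFin \o (h \* k)).
  by move=> h2 k2; apply/Lfun1_integrable/Lfun2_mul_Lfun1.
split.
- apply: eq_integrable (integrableD measurableT (I _ _ rf rg) (I _ _ mf mg)) => // x _ /=.
  by case: (f x) (g x) => a b [a' b'] /=; rewrite mulrN opprK.
- apply: eq_integrable (integrableB measurableT (I _ _ mf rg) (I _ _ rf mg)) => // x _ /=.
  by case: (f x) (g x) => a b [a' b'] /=; rewrite mulrN addrC (mulrC b).
Qed.

Definition L2_inner (u v : L2) : R[i] :=
  cintegral (fun x => repr u x * (repr v x)^*).

Lemma L2_inner_pi (f g : L2pre) :
  L2_inner (\pi_L2 f) (\pi_L2 g) = cintegral (fun x => f x * (g x)^*).
Proof.
apply: ae_eq_cintegral; [exact: L2_integrable|exact: L2_integrable|].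
by apply: filterS2 (L2_reprP f) (L2_reprP g) => x -> ->.
Qed.

Lemma L2_innerC u v : L2_inner u v = (L2_inner v u)^*.
Proof.
rewrite /L2_inner -cintegral_conj; last exact: L2_integrable.
by congr cintegral; apply/funext => x; rewrite rmorphM/= conjCK mulrC.
Qed.

Lemma L2_inner_linearl v : linear_for *%R (L2_inner^~ v).
Proof.
move=> a u u'; rewrite -[u]reprK -[u']reprK -[v]reprK.
rewrite -L2_piZ -L2_piD !L2_inner_pi -cintegralZ; last exact: L2_integrable.
rewrite -cintegralD; last 2 first.
- exact/cintegrableZ/L2_integrable.
- exact: L2_integrable.
by congr cintegral; apply/funext => x; rewrite mulrA -mulrDl.
Qed.

Lemma L2_inner_bilinear :
  bilinear_for *%R (conjC \; *%R) (L2_inner : L2 -> L2 -> R[i]).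
Proof.
split=> [v|v]; first exact: L2_inner_linearl.
move=> a u u'; rewrite L2_innerC L2_inner_linearl rmorphD rmorphM/=.
by rewrite -!L2_innerC.
Qed.

HB.instance Definition _ := bilinear_isBilinear.Build R[i] L2 L2 R[i]
  *%R (conjC \; *%R) L2_inner L2_inner_bilinear.

Lemma L2_inner_herm u v : L2_inner u v = (-1) ^+ false * (L2_inner v u)^*.
Proof. by rewrite expr0 mul1r L2_innerC. Qed.

HB.instance Definition _ := isHermitianSesquilinear.Build R[i] L2 false conjC
  L2_inner L2_inner_herm.

Lemma L2_inner_gt0 u : u != 0 -> 0 < L2_inner u u.
Proof.
move=> u0.
pose h (x : T) : R := Re (repr u x) ^+ 2 + Im (repr u x) ^+ 2.
have uE x : repr u x * (repr u x)^* = (h x)%:C by rewrite add_Re2_Im2 normCK.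
have h0 x : 0 <= h x by rewrite addr_ge0 ?sqr_ge0.
have [hint _] := L2_integrable (repr u) (repr u).
have {}hint : mu.-integrable setT (EFin \o h).
  by apply: eq_integrable hint => // x _; rewrite /= uE.
have -> : L2_inner u u = (\int[mu]_x h x)%:C.
  rewrite /L2_inner /cintegral; congr (_ +i* _).
    by apply: eq_Rintegral => x _; rewrite uE.
  rewrite /Rintegral; under eq_integral do rewrite uE/=.
  by rewrite integral0.
rewrite ltcR lt_neqAle Rintegral_ge0 ?andbT//.
apply: contra_neq u0 => /esym Ih; rewrite -[u]reprK -L2_pi0; apply/L2_piP.
have mh := measurable_int mu hint.
have /(ae_eq_integral_abs mu measurableT mh) : (\int[mu]_x `|(EFin \o h) x| = 0)%E.
  under eq_integral do rewrite gee0_abs ?lee_fin//.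
  by rewrite -[LHS]fineK ?integrable_fin_num//= -[X in X = _]/(Rintegral _ _ _)%:E Ih.
apply: filterS => x /(_ I) [] /eqP.
rewrite paddr_eq0 ?sqr_ge0// !sqrf_eq0 => /andP[/eqP r0 /eqP i0].
by apply/eqP; rewrite eq_complex r0 i0 !eqxx.
Qed.

HB.instance Definition _ := isDotProduct.Build R[i] L2 L2_inner L2_inner_gt0.

HB.instance Definition _ := Lmodule_isPreHilbert.Build R L2 L2_inner.

End ComplexL2.

Section BoundedOperators.
Context (R : realType) (V W : preHilbertType R).
Implicit Types A : V -> W.

Definition bounded_op A := exists M : R, forall u, `|A u| <= M%:C * `|u|.

(* Norms live in R[i]; Re reads the (real) norm as an element of R. *)
Definition op_norm A : R := sup [set Re `|A u| | u in [set u : V | `|u| <= 1]].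

Definition is_unitary A :=
  bijective A /\ forall u v, inner (A u) (A v) = inner u v.

(* For bounded linear A on a complete space the Riesz theorem makes this set a
   singleton; the default value of xget is then never used. *)
Definition adjoint A (w : W) : V :=
  xget 0 [set v | forall u, inner (A u) w = inner u v].

End BoundedOperators.

Definition separable (T : topologicalType) :=
  exists2 D : set T, countable D & dense D.

(* A linear operator defined on a subspace; the values of [op] outside of
   [dom] are irrelevant. *)
Record unbounded_op (R : realType) (V : preHilbertType R) := UnboundedOp {
  dom : set V ;
  op :> V -> V ;
  dom0 : dom 0 ;
  dom_linear : forall (a : R[i]) u v, dom u -> dom v -> dom (a *: u + v) ;
  op_linear : forall (a : R[i]) u v, dom u -> dom v ->
    op (a *: u + v) = a *: op u + op v
}.

Section UnboundedOperators.
Context (R : realType) (V : preHilbertType R).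
Implicit Types (A : unbounded_op V) (z : R[i]).

Definition op_graph A : set (V * V) := [set p | dom A p.1 /\ A p.1 = p.2].

Definition adjoint_graph A : set (V * V) :=
  [set p | forall u, dom A u -> inner (A u) p.1 = inner u p.2].

(* When dom A is dense, adjoint_graph A is the graph of the adjoint of A. *)
Definition self_adjoint A := dense (dom A) /\ adjoint_graph A = op_graph A.

Definition shift A z (u : V) : V := A u - z *: u.

Definition resolvent_set A : set R[i] :=
  [set z | set_bij (dom A) [set: V] (shift A z) /\
    exists M : R, forall u, dom A u -> `|u| <= M%:C * `|shift A z u|].

Definition spectrum A : set R[i] := ~` resolvent_set A.

Definition resolvent A z (v : V) : V :=
  xget 0 [set u | dom A u /\ shift A z u = v].

Definition eigen_space A z : set V := [set u | dom A u /\ shift A z u = 0].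

Definition point_spectrum A : set R[i] :=
  [set z | exists2 u, eigen_space A z u & u != 0].

Definition finite_dimensional (E : set V) := exists (n : nat) (e : 'I_n -> V),
  E = [set \sum_(i < n) c i *: e i | c in [set: 'I_n -> R[i]]].

Definition orth_proj (E : set V) (u : V) : V :=
  xget 0 [set p | E p /\ forall v, E v -> inner (u - p) v = 0].

End UnboundedOperators.

Section Multiplication.
Context d (T : measurableType d) (R : realType).
Variables (mu : {measure set T -> \bar R}) (g : T -> R).

Definition mul_rel (u v : L2 mu) :=
  \forall x \ae mu, repr v x = (g x)%:C * repr u x.

Definition mul_dom : set (L2 mu) := [set u | exists v, mul_rel u v].

Definition mul_fun (u : L2 mu) : L2 mu := xget 0 [set v | mul_rel u v].

Lemma mul_rel_uniq u v v' : mul_rel u v -> mul_rel u v' -> v = v'.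
Proof. by move=> uv uv'; apply/L2P; apply: filterS2 uv uv' => x -> ->. Qed.

Lemma mul_funE u v : mul_rel u v -> mul_fun u = v.
Proof.
by move=> uv; apply: xget_unique => // v' uv'; exact: mul_rel_uniq uv' uv.
Qed.

Lemma mul_rel_linear (a : R[i]) u u' v v' :
  mul_rel u v -> mul_rel u' v' -> mul_rel (a *: u + u') (a *: v + v').
Proof.
have rE (f h : L2 mu) :
    \forall x \ae mu, repr (a *: f + h) x = a * repr f x + repr h x.
  rewrite -[X in repr X](_ : \pi_(L2 mu)%qT (a *: repr f + repr h) = _).
    exact: L2_reprP.
  by rewrite L2_piD L2_piZ !reprK.
move=> uv uv'.
apply: filterS2 (filterI uv uv') (filterI (rE u u') (rE v v')).
by move=> x [vx vx'] [-> ->]; rewrite vx vx' mulrDr mulrCA.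
Qed.

Lemma mul_dom0 : mul_dom 0.
Proof.
exists 0; rewrite /mul_rel -L2_pi0; apply: filterS (L2_reprP 0) => x ->.
by rewrite mulr0.
Qed.

Lemma mul_dom_linear (a : R[i]) u v :
  mul_dom u -> mul_dom v -> mul_dom (a *: u + v).
Proof.
by move=> [u' uu'] [v' vv']; exists (a *: u' + v'); exact: mul_rel_linear.
Qed.

Lemma mul_fun_linear (a : R[i]) u v : mul_dom u -> mul_dom v ->
  mul_fun (a *: u + v) = a *: mul_fun u + mul_fun v.
Proof.
move=> [u' uu'] [v' vv']; rewrite (mul_funE uu') (mul_funE vv').
exact/mul_funE/mul_rel_linear.
Qed.

(* Multiplication by g, on its maximal domain: all u in L2 with g u in L2. *)
Definition mulop : unbounded_op (L2 mu) :=
  UnboundedOp mul_dom0 mul_dom_linear mul_fun_linear.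

End Multiplication.

Definition C0 (R : realType) (w : R -> R) :=
  [/\ continuous w, w x @[x --> +oo] --> (0 : R) & w x @[x --> -oo] --> (0 : R)].

Section Rigging.
Context (R : realType) (V K : hilbertType R).
Variable mu : {measure set (measurableTypeR R) -> \bar R}.

(* U H U^-1 = M_x as unbounded operators, domains included; the target being
   one scalar L^2 space, this forces H to have multiplicity one. *)
Definition spectral_transformation (H : unbounded_op V) (U : V -> L2 mu) :=
  [/\ is_unitary U,
      forall u, dom H u <-> dom (mulop mu id) (U u) &
      forall u, dom H u -> U (H u) = mulop mu id (U u)].

Definition rigging (J : L2 mu -> K) (w : R -> R) (U : V -> L2 mu) : V -> K :=
  J \o mulop mu w \o U.

Definition sandwiched_resolvent (H : unbounded_op V) (F : V -> K) (z : R[i])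
  : K -> K := F \o resolvent H z \o adjoint F.

End Rigging.

(* Main.v *)
Require Import Defs.
From mathcomp Require Import all_boot all_order all_algebra complex.
From mathcomp Require Import ring lra.
From mathcomp Require Import all_classical all_reals all_analysis.
From mathcomp Require Import measurable_realfun.

(** The operator norm of T_z blows up because a single quadratic form of T_z
    does.  Put z = lambda + iy.  Since F P_lambda <> 0, there is an eigenvector
    e with H e = lambda e and |F e| = 1.  Let k = F e, g = F^* k and
    u = (H - z)^-1 g, so that <T_z k, k> = <F u, k> = <u, g>.  Two identities
    follow from the symmetry of H alone.

    Pairing g = (H - z) u with u and taking imaginary parts, where <H u, u> is
    real, gives Im <u, g> = y |u|^2.

    Pairing g = (H - z) u with e gives 1 = |F e|^2 = <g, e> = - i y <u, e>,
    and Cauchy-Schwarz then gives y |u| |e| >= 1.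

    Hence |T_z| >= |<T_z k, k>| >= y |u|^2 >= 1 / (y |e|^2), the bound of
    [op_norm_sandwiched_resolvent_ge], which tends to infinity as y decreases
    to 0.

    The rest of the work makes this computation legitimate.  The supremum
    defining the operator norm bounds the values of T_z only if T_z is bounded,
    which takes three ingredients.  The resolvent at lambda + iy exists and is
    bounded for all small y > 0, because lambda is isolated in the spectrum
    ([isolated_resolvent_set]).  The operator F is bounded, because a function
    in C_0 is bounded, multiplication by it is a bounded operator on L^2, and U
    is an isometry ([rigging_bounded]).  Finally F^* is a genuine adjoint, which
    is the Riesz representation theorem ([riesz_representation], [adjointP]). *)

Import Order.TTheory GRing.Theory Num.Theory.
Import numFieldNormedType.Exports.
Local Open Scope classical_set_scope.
Local Open Scope complex_scope.
Local Open Scope ring_scope.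

Local Notation Re := (@complex.Re _).
Local Notation Im := (@complex.Im _).

(** * Real-valued norms in a pre-Hilbert space *)

Section RealNorm.
Context {R : realType} {V : preHilbertType R}.
Implicit Types (u v : V) (a : R[i]).

(** The norm takes values in R[i]; working with its real part makes the tactics
    for ordered fields available. *)
Definition real_norm u : R := Re `|u|.

Lemma real_normE u : `|u| = (real_norm u)%:C.
Proof.
have := normr_ge0 u; rewrite lecE/= => /andP[/eqP im0 _].
by apply/eqP; rewrite eq_complex/= im0 !eqxx.
Qed.

Lemma real_norm_ge0 u : 0 <= real_norm u.
Proof. by rewrite -lecR -real_normE normr_ge0. Qed.

Lemma real_normZ (a : R) u : real_norm (a%:C *: u) = `|a| * real_norm u.
Proof.
rewrite /real_norm normrZ [`|u|]real_normE normc_def/= expr0n addr0 sqrtr_sqr.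
by rewrite mul0r subr0.
Qed.

Lemma inner_real_norm u : inner u u = (real_norm u ^+ 2)%:C.
Proof. by rewrite inner_norm real_normE rmorphXn. Qed.

Lemma innerC u v : inner u v = (inner v u)^*.
Proof. by rewrite hermC/= expr0 mul1r. Qed.

Lemma innerDl u v x : inner (u + v) x = inner u x + inner v x.
Proof. exact: linearDl. Qed.

Lemma innerZl a u x : inner (a *: u) x = a * inner u x.
Proof. exact: linearZl_LR. Qed.

Lemma innerDr u v x : inner x (u + v) = inner x u + inner x v.
Proof. exact: linearDr. Qed.

Lemma innerZr a u x : inner x (a *: u) = a^* * inner x u.
Proof. exact: linearZr_LR. Qed.

Lemma inner_cauchy_schwarz u v : `|inner u v| <= (real_norm u * real_norm v)%:C.
Proof.
have dn x : dot_norm inner x = (real_norm x)%:C.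
  by rewrite /dot_norm inner_norm sqrCK ?normr_ge0// real_normE.
by rewrite (rmorphM (real_complex R))/= -!dn; exact: cauchy_schwarz.
Qed.

End RealNorm.

(** * Riesz representation by minimization *)

Section Riesz.
Context {R : realType} {V : hilbertType R}.
Variables (phi : V -> R[i]) (M : R).
Hypotheses (phi_lin : scalar phi) (phi_bnd : forall u, `|phi u| <= M%:C * `|u|).

(** The representing vector v of phi is the minimizer of this functional: if
    phi = <., v>, then it equals |u - v|^2 - |v|^2. *)
Let energy (u : V) : R := real_norm u ^+ 2 - 2 * Re (phi u).

(** Half the derivative of the energy at u in the direction h, up to taking
    the real part; u represents phi exactly when it vanishes for all h. *)
Let defect (u h : V) : R[i] := inner h u - phi h.

(** The energy is a quadratic polynomial along every complex line, whose
    leading coefficient does not depend on u: this gives both the strict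
    convexity and the first-order condition used below. *)
Lemma energy_line u h (t : R[i]) : energy (u + t *: h) =
  energy u + Re (t * t^*) * real_norm h ^+ 2 + 2 * Re (t * defect u h).
Proof.
have sqE (x : V) : real_norm x ^+ 2 = Re (inner x x) by rewrite inner_real_norm.
rewrite /energy /defect !sqE [u + _]addrC phi_lin.
rewrite !innerDl !innerDr !innerZl !innerZr [inner u h]innerC.
have := inner_real_norm h.
case: (inner h h) => p q /eqP; rewrite eq_complex/= => /andP[_ /eqP->].
case: (inner u u) => e f; case: (inner h u) => a b.
case: (phi h) => c d; case: (phi u) => g k; case: t => t s /=; ring.
Qed.

Lemma energy_ge u : - M ^+ 2 <= energy u.
Proof.
have ph : Re (phi u) <= M * real_norm u.
  have := le_trans (normc_ge_Re (phi u)) (phi_bnd u).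
  rewrite real_normE -(rmorphM (real_complex R))/= lecR.
  exact/le_trans/ler_norm.
have := sqr_ge0 (real_norm u - M); rewrite /energy; nra.
Qed.

Let m := inf (range energy).

Lemma energy_inf u : m <= energy u.
Proof.
apply: ge_inf; last by exists u.
by exists (- M ^+ 2) => _ [v _ <-]; exact: energy_ge.
Qed.

Lemma minimizing_sequence :
  exists u : nat -> V, forall n, energy (u n) < m + n.+1%:R^-1.
Proof.
suff /choice[u uP] : forall n, exists v, energy v < m + n.+1%:R^-1 by exists u.
move=> n; have n0 : 0 < n.+1%:R^-1 :> R by rewrite invr_gt0 ltr0n.
have [|_ [v _ <-] ?] := inf_adherent n0 (E := range energy); last by exists v.
split; first by exists (energy 0), 0.
by exists (- M ^+ 2) => _ [v _ <-]; exact: energy_ge.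
Qed.

(** Strict convexity: the energy at the midpoint of u and v is the mean of the
    energies of u and v minus |u - v|^2 / 4, and it is at least the infimum.
    This makes minimizing sequences Cauchy. *)
Lemma almost_minimizers_close u v (e : R) :
  energy u < m + e -> energy v < m + e -> real_norm (u - v) ^+ 2 <= 4 * e.
Proof.
move=> ue ve; set d := u - v.
have uE : u = v + 1 *: d by rewrite scale1r addrC subrK.
have := energy_inf (v + (2^-1)%:C *: d).
rewrite energy_line; move: ue; rewrite {1}uE energy_line.
case: (defect v d) => a b /=; rewrite ?(mul1r, mulr1, mul0r, mulr0, oppr0, subr0).
nra.
Qed.

(** A step from u along h in the direction opposite to the defect lowers the
    energy by about |defect u h|^2 / |h|^2, but cannot lower it by more than e. *)
Lemma almost_minimizer_defect u h (e : R) : energy u < m + e ->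
  Re (`|defect u h| ^+ 2) <= e * (real_norm h ^+ 2 + 1).
Proof.
move=> ue; set N := real_norm h ^+ 2; set D := defect u h.
have N0 : 0 <= N by exact: sqr_ge0.
have N1 : 0 < N + 1 by lra.
(* The optimal step length is 1 / |h|^2; adding 1 to the denominator covers
   h = 0 as well. *)
have := energy_inf (u + (- ((N + 1)^-1)%:C * D^*) *: h).
rewrite energy_line -/N -/D normCK.
have : 0 <= Re (D * D^*) by rewrite -normCK -add_Re2_Im2 addr_ge0 ?sqr_ge0.
case: D => a b /=; rewrite ?(mul1r, mulr1, mul0r, mulr0, oppr0, subr0).
set s := (N + 1)^-1 => ab0 lem.
have sN : s * (N + 1) = 1 by rewrite /s mulVf// gt_eqF.
have s0 : 0 < s by rewrite invr_gt0.
set q := a * a + b * b.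
have sq : s * q <= e.
  have qE : a * a - b * - b = q by rewrite /q; ring.
  rewrite qE in ab0.
  have s0' := ltW s0; have : 0 <= s * q * s by rewrite !mulr_ge0.
  have : s * q * (s * N) = s * q - s * q * s.
    by rewrite -{2}[s * q]mulr1 -sN; ring.
  move: lem; rewrite [X in m <= X](_ : _ =
    energy u + s * q * (s * N) - 2 * (s * q)); last by rewrite /q; ring.
  lra.
have -> : a * a - b * - b = s * q * (N + 1) by rewrite mulrAC sN mul1r /q; ring.
by apply: ler_wpM2r => //; exact: ltW.
Qed.

(** A minimizing sequence is Cauchy and its defects tend to 0, so its limit, which
    exists by completeness, has zero defect. *)
Lemma riesz_representation : exists v, forall u, phi u = inner u v.
Proof.
have [u uP] := minimizing_sequence.
have inv_small (e : R) : 0 < e -> \forall n \near \oo, n.+1%:R^-1 < e.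
  move=> e0; have := near_infty_natSinv_lt (PosNum e0).
  by apply: filterS => n /=.
have monoE (i j : nat) : (i <= j)%N -> energy (u j) < m + i.+1%:R^-1.
  move=> ij; apply: (lt_le_trans (uP j)).
  by rewrite lerD2l lef_pV2 ?posrE ?ltr0n// ler_nat.
have /cauchy_cvg uc : cauchy (u @ \oo).
  apply: cauchy_exP => eps eps0.
  have [e e0 epsE] : exists2 e : R, 0 < e & eps = e%:C.
    case: eps eps0 => a b; rewrite ltcE/= => /andP[/eqP -> a0]; by exists a.
  have e40 : 0 < e ^+ 2 / 4 by rewrite divr_gt0 ?exprn_gt0.
  have [N _ NP] := inv_small _ e40.
  exists (u N), N => //= n Nn; rewrite -ball_normE/= epsE real_normE ltcR.
  rewrite -(ltr_pXn2r (_ : (0 < 2)%N)) ?nnegrE ?real_norm_ge0 ?ltW//.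
  apply: le_lt_trans (almost_minimizers_close _ _ _ (uP N) (monoE _ _ Nn)) _.
  by rewrite mulrC -ltr_pdivlMr// NP/=.
pose l := lim (u @ \oo).
have /cvgrPdist_lt ul : u @ \oo --> l by exact: uc.
exists l => h; apply/eqP; rewrite eq_sym -subr_eq0 -normr_le0.
have cN : 0 < 2 * (real_norm h ^+ 2 + 1) by rewrite mulr_gt0// ltr_wpDl ?sqr_ge0.
(* Sending e to 0 kills the defect of the limit; the factor beyond e depends
   on h only. *)
suff key (e : R) : 0 < e ->
    `|inner h l - phi h| <= (e * (2 * (real_norm h ^+ 2 + 1)))%:C.
  apply/ler_addgt0Pr => -[a b]; rewrite ltcE/= => /andP[/eqP -> a0].
  have := key (a / (2 * (real_norm h ^+ 2 + 1))) (divr_gt0 a0 cN).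
  by rewrite divfK ?gt_eqF// add0r.
move=> e0.
have [n [n1 n2]] : exists n, real_norm (l - u n) < e /\ n.+1%:R^-1 < e ^+ 2.
  have ec : 0 < e%:C :> R[i] by rewrite ltcR.
  have ee : 0 < e ^+ 2 by rewrite exprn_gt0.
  near \oo => n; exists n; split; last by near: n; exact: inv_small.
  by rewrite -ltcR -real_normE; near: n; exact: ul.
have -> : inner h l - phi h = inner h (l - u n) + defect (u n) h.
  by rewrite /defect addrA -innerDr subrK.
apply: le_trans (ler_normD _ _) _.
set N := real_norm h ^+ 2; have N0 : 0 <= N by exact: sqr_ge0.
have -> : e * (2 * (N + 1)) = e * (N + 1) + e * (N + 1) by ring.
rewrite (rmorphD (real_complex R))/=; apply: lerD.
  apply: le_trans (inner_cauchy_schwarz _ _) _; rewrite lecR mulrC.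
  have := real_norm_ge0 h; have := real_norm_ge0 (l - u n).
  have : real_norm h <= N + 1 by rewrite /N; nra.
  nra.
have := almost_minimizer_defect _ h _ (uP n).
rewrite -/N normc_def; set D := defect (u n) h.
set r := Num.sqrt _; have r0 : 0 <= r by exact: sqrtr_ge0.
rewrite lecR -(rmorphXn (real_complex R))/= => rN.
have e0' := ltW e0; rewrite -(ler_pXn2r (_ : (0 < 2)%N)) ?nnegrE ?mulr_ge0 ?addr_ge0//.
apply: (le_trans rN); rewrite exprMn.
have : n.+1%:R^-1 * (N + 1) <= e ^+ 2 * (N + 1) by rewrite ler_wpM2r ?addr_ge0// ltW.
move=> /le_trans; apply; rewrite ler_wpM2l ?sqr_ge0//; nra.
Unshelve. all: by end_near. Qed.

End Riesz.

(** * Multiplication by a bounded function on complex L^2 *)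

(** Beyond A and B the limits at infinity control w, and in between it attains
    its maximum on a compact interval. *)
Lemma C0_bounded (R : realType) (w : R -> R) : C0 w ->
  exists2 W : R, 0 <= W & forall x, `|w x| <= W.
Proof.
move=> [cw wp wm].
have /cvgrPdist_le/(_ _ ltr01)[A [_ wA]] := wp.
have /cvgrPdist_le/(_ _ ltr01)[B [_ wB]] := wm.
have cn : {within `[Num.min A B, Num.max A B], continuous (fun x => `|w x|)}.
  apply: continuous_subspaceT => x.
  by apply: continuous_comp; [exact: cw|exact: norm_continuous].
have AB : Num.min A B <= Num.max A B by rewrite ge_min !le_max lexx.
have [c _ wc] := EVT_max AB cn.
exists (1 + `|w c|) => [|x]; first by rewrite addr_ge0.
have [xA|xA] := ltP A x.
  by have := wA _ xA; rewrite sub0r normrN; have := normr_ge0 (w c); lra.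
have [xB|xB] := ltP x B.
  by have := wB _ xB; rewrite sub0r normrN; have := normr_ge0 (w c); lra.
have := wc x; rewrite in_itv/= ge_min le_max xA xB orbT => /(_ isT); lra.
Qed.

Section BoundedMultiplication.
Context d (T : measurableType d) (R : realType).
Variables (mu : {measure set T -> \bar R}) (g : T -> R) (W : R).
Hypotheses (mg : measurable_fun setT g) (W0 : 0 <= W) (gW : forall x, `|g x| <= W).

Lemma sqr_bound x (z : R[i]) :
  Re (((g x)%:C * z) * ((g x)%:C * z)^*) <= W ^+ 2 * Re (z * z^*).
Proof.
case: z => a b /=.
have : g x ^+ 2 <= W ^+ 2 by rewrite -real_normK ?num_real// lerXn2r ?nnegrE.
have := sqr_ge0 a; have := sqr_ge0 b; nra.
Qed.

Lemma mul_L2fun (u : L2pre mu) : (fun x => (g x)%:C * u x) \in L2fun mu.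
Proof.
have /set_mem[mr mi uu] := L2pre_funP u.
have ReE : Re \o (fun x => (g x)%:C * u x) = g \* (Re \o u).
  by apply/funext => x /=; case: (u x) => a b /=; rewrite mul0r subr0.
have ImE : Im \o (fun x => (g x)%:C * u x) = g \* (Im \o u).
  by apply/funext => x /=; case: (u x) => a b /=; rewrite mul0r addr0.
have msq (f : T -> R[i]) : measurable_fun setT (Re \o f) ->
    measurable_fun setT (Im \o f) ->
    measurable_fun setT (fun x => (Re (`|f x| ^+ 2))%:E).
  move=> mf mh; under eq_fun do rewrite Re_sqr_norm.
  by apply/measurable_EFinP/measurable_funD; exact/measurable_funX.
have mgr : measurable_fun setT (g \* (Re \o u)) by exact: measurable_funM.
have mgi : measurable_fun setT (g \* (Im \o u)) by exact: measurable_funM.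
rewrite inE; split; rewrite ?ReE ?ImE//.
apply: le_lt_trans (_ : (\int[mu]_x ((W ^+ 2)%:E * (Re (`|u x| ^+ 2))%:E) < +oo)%E).
  apply: ge0_le_integral => //.
  - by move=> x _; rewrite lee_fin Re_sqr_norm addr_ge0 ?sqr_ge0.
  - by apply: msq; rewrite ?ReE ?ImE.
  - by apply: measurable_funeM; exact: msq.
  - by move=> x _; rewrite -EFinM lee_fin !normCK sqr_bound.
rewrite ge0_integralZl//; first by rewrite lte_mul_pinfty ?lee_fin ?sqr_ge0.
- exact: msq.
- by move=> x _; rewrite lee_fin Re_sqr_norm addr_ge0 ?sqr_ge0.
- by rewrite lee_fin sqr_ge0.
Qed.

(** Boundedness comes with totality: since [mul_fun] returns a default value
    outside of its domain, the norm estimate concerns the product g u only once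
    u is known to lie in the domain. *)
Lemma mulop_bounded (u : L2 mu) :
  dom (mulop mu g) u /\ `|mulop mu g u| <= W%:C * `|u|.
Proof.
pose f := Build_L2pre (mul_L2fun (repr u)).
pose v : L2 mu := \pi_(L2 mu)%qT f.
have uv : mul_rel g u v by apply: filterS (L2_reprP f) => x ->.
split; first by exists v.
rewrite [mulop mu g u](mul_funE uv) !real_normE -(rmorphM (real_complex R)) lecR.
rewrite -(ler_pXn2r (_ : (0 < 2)%N)) ?nnegrE ?mulr_ge0 ?real_norm_ge0//.
rewrite exprMn.
have sqE (h : L2pre mu) : real_norm (\pi_(L2 mu)%qT h : L2 mu) ^+ 2 =
    \int[mu]_x Re (h x * (h x)^*).
  have := inner_real_norm (\pi_(L2 mu)%qT h : L2 mu).
  by rewrite [inner _ _]L2_inner_pi => /(congr1 Re).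
have := sqE (repr u); rewrite reprK => ->.
rewrite (sqE f : real_norm v ^+ 2 = _) -RintegralZl//;
  last by have [] := L2_integrable (repr u) (repr u).
apply: le_Rintegral => //.
- by have [] := L2_integrable f f.
- have [iu _] := L2_integrable (repr u) (repr u).
  exact: eq_integrable (integrableZl measurableT (W ^+ 2) iu).
- by move=> x _; exact: sqr_bound.
Qed.

End BoundedMultiplication.

(** * Bounded operators and adjoints *)

Lemma bounded_op_ge0 (R : realType) (V W : preHilbertType R) (A : V -> W) :
  bounded_op A ->
  exists2 M : R, 0 <= M & forall u, real_norm (A u) <= M * real_norm u.
Proof.
move=> [M AM]; exists `|M| => // u; have := AM u.
rewrite !real_normE -(rmorphM (real_complex R)) lecR => /le_trans; apply.
by rewrite ler_wpM2r ?real_norm_ge0// ler_norm.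
Qed.

Section Adjoint.
Context {R : realType} {V : hilbertType R} {K : preHilbertType R}.
Variable F : V -> K.
Hypotheses (linF : linear F) (bF : bounded_op F).

(** The Riesz theorem represents the bounded functional u |-> <F u, k>, so that
    [adjoint] never returns its default value. *)
Lemma adjointP u k : inner (F u) k = inner u (adjoint F k).
Proof.
move: u; rewrite /adjoint; case: xgetP => [v _ //|noadj].
have [M M0 FM] := bounded_op_ge0 _ _ _ _ bF.
have lin : scalar (fun u => inner (F u) k).
  by move=> a u v; rewrite linF innerDl innerZl.
have bnd u : `|inner (F u) k| <= (M * real_norm k)%:C * `|u|.
  apply: le_trans (inner_cauchy_schwarz _ _) _.
  rewrite real_normE -(rmorphM (real_complex R)) lecR mulrAC.
  by rewrite ler_wpM2r ?real_norm_ge0.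
have [v vP] := riesz_representation _ _ lin bnd.
by have := noadj v; case.
Qed.

(** With g = F^* k, one has |g|^2 = <F g, k> <= M |g| |k|. *)
Lemma adjoint_bound M k : 0 <= M ->
  (forall u, real_norm (F u) <= M * real_norm u) ->
  real_norm (adjoint F k) <= M * real_norm k.
Proof.
move=> M0 FM; set g := adjoint F k.
have [g0|g0] := eqVneq (real_norm g) 0.
  by rewrite g0 mulr_ge0 ?real_norm_ge0.
have gp : 0 < real_norm g by rewrite lt_def g0 real_norm_ge0.
rewrite -(ler_pM2l gp) -expr2.
have : (real_norm g ^+ 2)%:C <= (real_norm (F g) * real_norm k)%:C.
  rewrite -inner_real_norm -adjointP; apply: le_trans (inner_cauchy_schwarz _ _).
  by rewrite adjointP inner_real_norm ger0_norm// lecR sqr_ge0.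
rewrite lecR => /le_trans; apply; rewrite mulrCA mulrA.
by rewrite ler_wpM2r ?real_norm_ge0.
Qed.

End Adjoint.

(** The boundedness of A matters: the supremum of an unbounded set of reals is 0
    by convention. *)
Lemma op_norm_ge (R : realType) (V W : preHilbertType R) (A : V -> W) u :
  bounded_op A -> real_norm u <= 1 -> real_norm (A u) <= op_norm A.
Proof.
move=> /bounded_op_ge0[M M0 AM] u1; apply: ub_le_sup; last first.
  by exists u => //=; rewrite real_normE lecR.
exists M => _ [v /= v1 <-]; apply: le_trans (AM v) _.
by rewrite ler_piMr// -lecR -real_normE.
Qed.

(** * The sandwiched resolvent near an eigenvalue *)

Section SandwichedResolvent.
Context {R : realType} {V K : hilbertType R}.
Variables (H : unbounded_op V) (F : V -> K).
Hypotheses (linF : linear F) (bF : bounded_op F).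

Lemma resolventP z v : resolvent_set H z ->
  dom H (resolvent H z v) /\ Defs.shift H z (resolvent H z v) = v.
Proof.
move=> [[_ _ /(_ v I)[u Hu uv]] _].
by apply: (xgetPex 0 (P := [set u | dom H u /\ Defs.shift H z u = v])); exists u.
Qed.

Lemma sandwiched_resolvent_bounded z : resolvent_set H z ->
  bounded_op (sandwiched_resolvent H F z).
Proof.
move=> Hz; have [_ [N HN]] := Hz.
have [M M0 FM] := bounded_op_ge0 _ _ _ _ bF.
exists (M * (`|N| * M)) => k; rewrite /sandwiched_resolvent/=.
have [du su] := resolventP z (adjoint F k) Hz.
have := HN _ du; rewrite su; set u := resolvent _ _ _.
rewrite !real_normE -!(rmorphM (real_complex R)) !lecR => uN.
apply: le_trans (FM _) _; rewrite -mulrA; apply: ler_wpM2l => //.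
apply: (le_trans uN); apply: le_trans (_ : `|N| * real_norm (adjoint F k) <= _).
  by rewrite ler_wpM2r ?real_norm_ge0// ler_norm.
by rewrite -mulrA ler_wpM2l// adjoint_bound.
Qed.

Hypothesis symH : forall u v, dom H u -> dom H v -> inner (H u) v = inner u (H v).

(** The value of T_z at the unit vector k = F e already has norm at least
    Im <u, g> = y |u|^2, where g = F^* k and u = (H - z)^-1 g, while
    y |u| |e| >= 1 because the component of u along e is exactly
    <u, e> = i / y. *)
Lemma op_norm_sandwiched_resolvent_ge (lambda y : R) (e : V) :
  0 < y -> resolvent_set H (lambda +i* y) ->
  eigen_space H lambda%:C e -> real_norm (F e) = 1 ->
  (y * real_norm e ^+ 2)^-1 <= op_norm (sandwiched_resolvent H F (lambda +i* y)).
Proof.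
move=> y0 Hz [de /eqP]; rewrite subr_eq0 => /eqP He Fe.
apply: le_trans (op_norm_ge _ _ _ _ (F e) (sandwiched_resolvent_bounded _ Hz) _);
  last by rewrite Fe.
rewrite /sandwiched_resolvent/=.
have [] := resolventP _ (adjoint F (F e)) Hz.
set g := adjoint F (F e); set u := resolvent _ _ g => du su.
have HuE : H u = g + (lambda +i* y) *: u by rewrite -su subrK.
have ge1 : inner g e = 1.
  by rewrite innerC -adjointP// inner_real_norm Fe expr1n rmorph1.
have Im_ug : Im (inner u g) = y * real_norm u ^+ 2.
  have : inner u g = inner u (H u) - (lambda +i* y)^* * inner u u.
    by rewrite -innerZr -su linearBr.
  have : Im (inner u (H u)) = 0.
    have := symH u u du du; rewrite innerC; case: (inner u (H u)) => a b.
    by move=> /eqP; rewrite eq_complex/= => /andP[_ /eqP]; lra.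
  rewrite inner_real_norm; case: (inner u (H u)) => a b /= -> -> /=; ring.
have ue : 1 <= y * (real_norm u * real_norm e).
  have : inner g e = - (0 +i* y) * inner u e.
    have := symH u e du de; rewrite HuE He innerDl innerZl innerZr.
    move=> /(canRL (addrK _)) ->; rewrite -mulrBl; congr (_ * _).
    by apply/eqP; rewrite eq_complex/=; apply/andP; split; apply/eqP; ring.
  rewrite ge1 => /(congr1 Num.norm); rewrite normr1 normrM normrN => h1.
  have yn : `|0 +i* y| = y%:C by rewrite normc_def/= expr0n add0r sqrtr_sqr gtr0_norm.
  rewrite -lecR (rmorph1 (real_complex R)) (rmorphM (real_complex R)) h1 yn.
  by rewrite ler_wpM2l ?inner_cauchy_schwarz// lecR ltW.
have Fu : y * real_norm u ^+ 2 <= real_norm (F u).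
  have Im0 : 0 <= Im (inner u g) by rewrite Im_ug mulr_ge0 ?sqr_ge0 ?ltW.
  have := inner_cauchy_schwarz (F u) (F e); rewrite Fe mulr1 adjointP// -/g.
  rewrite -Im_ug normc_def lecR; apply: le_trans.
  by rewrite -[leLHS](ger0_norm Im0) -sqrtr_sqr ler_wsqrtr// lerDr sqr_ge0.
apply: le_trans Fu; have e0 := real_norm_ge0 e; have u0 := real_norm_ge0 u.
have ep : 0 < real_norm e.
  rewrite lt_def e0 andbT; apply/eqP => E; move: ue; rewrite E !mulr0; lra.
rewrite -div1r ler_pdivrMr ?mulr_gt0 ?exprn_gt0//.
have -> : y * real_norm u ^+ 2 * (y * real_norm e ^+ 2) =
  (y * (real_norm u * real_norm e)) ^+ 2 by ring.
by rewrite exprn_ege1.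
Qed.

End SandwichedResolvent.

Lemma self_adjoint_symmetric (R : realType) (V : preHilbertType R)
    (H : unbounded_op V) u v :
  self_adjoint H -> dom H u -> dom H v -> inner (H u) v = inner u (H v).
Proof.
move=> [_ adj] du dv.
by have : adjoint_graph H (v, H v) by [rewrite adj]; exact.
Qed.

(** * The rigging operator and the isolated eigenvalue *)

Section RiggingOperator.
Context {R : realType} {V K : hilbertType R}.
Variable mu : {measure set (measurableTypeR R) -> \bar R}.
Variables (w : R -> R) (J : {linear L2 mu -> K}) (U : {linear V -> L2 mu}).
Hypotheses (w_C0 : C0 w) (bJ : bounded_op J).

Lemma mulop_C0_bounded : exists2 W : R, 0 <= W & forall u : L2 mu,
  dom (mulop mu w) u /\ `|mulop mu w u| <= W%:C * `|u|.
Proof.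
have [W W0 wW] := C0_bounded _ _ w_C0.
have mw : measurable_fun [set: measurableTypeR R] w.
  by have [cw _ _] := w_C0; exact: continuous_measurable_fun.
by exists W => // u; exact: mulop_bounded.
Qed.

Lemma rigging_linear : linear (rigging J w U).
Proof.
have [W _ wW] := mulop_C0_bounded => a u v.
by rewrite /rigging/= linearP mul_fun_linear ?linearP//; apply wW.
Qed.

Lemma rigging_bounded : Defs.is_unitary U -> bounded_op (rigging J w U).
Proof.
move=> [_ innerU]; have [W W0 wW] := mulop_C0_bounded.
have [M M0 JM] := bounded_op_ge0 _ _ _ _ bJ.
exists (M * W) => u; rewrite /rigging/= !real_normE -(rmorphM (real_complex R)) lecR.
have Uu : real_norm (U u) = real_norm u.
  apply/eqP; rewrite -(@eqrXn2 _ 2%N) ?real_norm_ge0//; apply/eqP.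
  by have := innerU u u; rewrite !inner_real_norm => /(congr1 Re).
apply: le_trans (JM _) _; rewrite -mulrA ler_wpM2l// -Uu.
by have [_] := wW (U u); rewrite !real_normE -(rmorphM (real_complex R)) lecR.
Qed.

End RiggingOperator.

(** The points lambda + iy with y > 0 small lie in a neighbourhood of lambda whose
    only spectral point is lambda. *)
Lemma isolated_resolvent_set (R : realType) (V : preHilbertType R)
    (H : unbounded_op V) (lambda : R) :
  isolated (spectrum H : set R[i]^o) lambda%:C ->
  \forall y \near 0^'+, resolvent_set H (lambda +i* y).
Proof.
move=> [_ [A /nbhs_ballP[[d d'] /= d0 dA] AE]].
move: d0; rewrite ltcE/= => /andP[/eqP d'0 d0].
near=> y; have y0 : 0 < y by [].
apply: contrapT => specz.
have : (A `&` spectrum H) (lambda +i* y).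
  split => //; apply: dA; rewrite -ball_normE/=.
  have -> : lambda%:C - (lambda +i* y) = 0 +i* (- y).
    by apply/eqP; rewrite eq_complex/= subrr sub0r !eqxx.
  rewrite normc_def/= expr0n add0r sqrrN sqrtr_sqr gtr0_norm// d'0 ltcR.
  by near: y; exact: nbhs_right_lt.
rewrite AE => /eqP; rewrite eq_complex/= => /andP[_ /eqP].
by apply/eqP; rewrite gt_eqF.
Unshelve. all: by end_near. Qed.

(* R[i]^o is R[i] with the topology of its modulus. *)
Theorem proposition0p6 (R : realType) (V K : hilbertType R)
    (sepV : separable V) (sepK : separable K)
    (H : unbounded_op V) (saH : self_adjoint H)
    (mu : {measure set (measurableTypeR R) -> \bar R})
    (U : {linear V -> L2 mu}) (specU : spectral_transformation H U)
    (w : R -> R) (w_gt0 : forall x, 0 < w x) (w_C0 : C0 w)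
    (J : {linear L2 mu -> K}) (bJ : bounded_op J)
    (lambda : R)
    (eig : point_spectrum H lambda%:C)
    (iso : isolated (spectrum H : set R[i]^o) lambda%:C)
    (fin : finite_dimensional (eigen_space H lambda%:C))
    (nz : rigging J w U \o orth_proj (eigen_space H lambda%:C) <> cst 0) :
  op_norm (sandwiched_resolvent H (rigging J w U) (lambda +i* y))
    @[y --> 0^'+] --> +oo.
Proof.
have [unitU _ _] := specU.
have linF : linear (rigging J w U) by exact: rigging_linear.
have bF : bounded_op (rigging J w U) by exact: rigging_bounded.
set F := rigging J w U in nz linF bF *.
set E := eigen_space H lambda%:C in nz *.
have EZ a u : E u -> E (a *: u).
  move=> [du /eqP]; rewrite subr_eq0 => /eqP Hu.
  have := op_linear a du (dom0 H); have := dom_linear a du (dom0 H).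
  have H0 : H 0 = 0.
    have := op_linear 1 (dom0 H) (dom0 H).
    by rewrite !scale1r addr0 => /esym/eqP; rewrite -subr_eq0 addrK => /eqP.
  rewrite H0 !addr0 => dau Hau; split => //.
  by rewrite /Defs.shift Hau Hu scalerA mulrC -scalerA subrr.
have F0 : F 0 = 0.
  have := linF 1 0 0; rewrite !scale1r addr0 => /esym/eqP.
  by rewrite -subr_eq0 addrK => /eqP.
(* F not vanishing on the range of the projector yields an eigenvector, which
   can then be rescaled. *)
have [e Ee Fe] : exists2 e, E e & real_norm (F e) = 1.
  have [v Ev Fv] : exists2 v, E v & F v != 0.
    apply: contrapT => none; apply: nz; apply/funext => v /=.
    rewrite /orth_proj; case: xgetP => [p _ [Ep _]|_]; last exact: F0.
    by apply: contrapT => /eqP Fp; apply: none; exists p.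
  have FvN : real_norm (F v) != 0.
    by apply: contra_neq Fv => Fv0; apply/normr0_eq0; rewrite real_normE Fv0.
  exists ((real_norm (F v))^-1%:C *: v); first exact: EZ.
  have := linF (real_norm (F v))^-1%:C v 0; rewrite F0 !addr0 => ->.
  by rewrite real_normZ ger0_norm ?invr_ge0 ?real_norm_ge0// mulVf.
have e0 : 0 < real_norm e ^+ 2.
  rewrite exprn_gt0// lt_def real_norm_ge0 andbT; apply/eqP => e0.
  have e00 : e = 0 by apply/normr0_eq0; rewrite real_normE e0.
  by move: Fe; rewrite e00 F0 /real_norm normr0 => /esym/eqP; rewrite oner_eq0.
(* The bound 1 / (y |e|^2) is at least |A| + 1 once y is at most
   1 / ((|A| + 1) |e|^2); adding 1 avoids dividing by 0. *)
apply/cvgryPge => A; near=> y.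
have y0 : 0 < y by [].
have Hz : resolvent_set H (lambda +i* y).
  by near: y; exact: isolated_resolvent_set.
have symH u v : dom H u -> dom H v -> inner (H u) v = inner u (H v).
  exact: self_adjoint_symmetric.
apply: le_trans (op_norm_sandwiched_resolvent_ge _ _ linF bF symH _ _ _ y0 Hz Ee Fe).
have A1 : 0 < `|A| + 1 by rewrite ltr_wpDl.
apply: le_trans (_ : `|A| + 1 <= _).
  by rewrite (le_trans (ler_norm A))// lerDl.
have ye0 : 0 < y * real_norm e ^+ 2 by exact: mulr_gt0.
rewrite -[leLHS]invrK lef_pV2 ?posrE ?invr_gt0// -ler_pdivlMr//.
by near: y; apply: nbhs_right_le; rewrite divr_gt0 ?invr_gt0.
Unshelve. all: by end_near. Qed.
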